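(* Let $G$ be a graph with maximum degree $\Delta \ge 24$. Then $$\chi_a(G) < \min\left\{\frac32\Delta^{\frac43} + 5\Delta - 14,\ \ \frac32\Delta^{\frac43} + \Delta + \frac{8\Delta^{\frac43}}{\Delta^{\frac23}-4} + 1\right\}.$$
   Context: An acyclic coloring of a graph is a proper vertex-coloring in which no cycle is bicolored (equivalently, the subgraph induced by any two color classes is a forest). $\chi_a(G)$, the acyclic chromatic number, is the minimum number of colors in an acyclic coloring of $G$. *)

(* Defs.v *)
From HB Require Import structures.
From mathcomp Require Import all_boot all_order all_algebra.
From mathcomp Require Import all_classical all_reals all_analysis.
Set Implicit Arguments. Unset Strict Implicit. Unset Printing Implicit Defensive.

Definition simple_graph (T : finType) (e : rel T) : Prop :=
  symmetric e /\ irreflexive e.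

Definition deg (T : finType) (e : rel T) (v : T) : nat := #|[set u | e v u]|.
Definition max_deg (T : finType) (e : rel T) : nat := \max_(v : T) deg e v.

Definition is_graph_cycle (T : finType) (e : rel T) (p : seq T) : bool :=
  [&& uniq p, 3 <= size p & cycle e p].

Definition proper_coloring (T : finType) (e : rel T) k (c : T -> 'I_k) :=
  forall u v, e u v -> c u != c v.

Definition bicolored (T : finType) k (c : T -> 'I_k) (p : seq T) :=
  exists a b : 'I_k, all (fun v => (c v == a) || (c v == b)) p.

Definition acyclic_coloring (T : finType) (e : rel T) k (c : T -> 'I_k) :=
  proper_coloring e c /\
  forall p, is_graph_cycle e p -> ~ bicolored c p.

Definition acyclic_colorable (T : finType) (e : rel T) (k : nat) : Prop :=
  exists c : T -> 'I_k, acyclic_coloring e c.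

Lemma acyclic_colorable_card (T : finType) (e : rel T) :
  irreflexive e -> acyclic_colorable e #|T|.
Proof.
move=> irr; exists (@enum_rank T); split.
  move=> u v euv; apply/negP => /eqP /enum_rank_inj eq_uv.
  by move: euv; rewrite eq_uv irr.
move=> p /and3P [up szp _] [a [b /allP Hab]].
have Uc : uniq (map (@enum_rank T) p) by rewrite map_inj_uniq //; exact: enum_rank_inj.
have sub : {subset map (@enum_rank T) p <= [:: a; b]}.
  move=> x /mapP [v vp ->]; have := Hab v vp.
  by rewrite !inE.
have := uniq_leq_size Uc sub; rewrite size_map /=.
by move=> H; move: (leq_trans szp H).
Qed.

Lemma acyclic_colorable_ex (T : finType) (e : rel T) :
  irreflexive e -> exists k, acyclic_colorable e k.
Proof. by move=> irr; exists #|T|; apply: acyclic_colorable_card. Qed.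

Definition acyclic_chromatic (T : finType) (e : rel T) (irr : irreflexive e) : nat :=
  ex_minn (P := fun k => `[< acyclic_colorable e k >])
    (let: ex_intro k Hk := acyclic_colorable_ex irr in
     ex_intro _ k (asboolT Hk)).

(* Main.v *)
(* Let D be the maximum degree, x = D^(1/3), beta = x^4 / 2, and call two
   vertices special when they have more than x^2 common neighbours; special
   pairs are required to receive different colors. Rosenfeld's counting
   method: writing F(S) for the number of valid colorings of S, induction
   shows F(S + v) >= beta F(S). Of the k F(S) extensions of valid colorings to
   v, at most (D + s) F(S) clash at v with a neighbour or with one of its s
   special vertices. A coloring with a bicolored cycle of length 2l + 4
   through v is determined by its restriction to the complement of 2l + 2
   vertices of that cycle, v among them, so that each cycle accounts for at
   most F(S) / beta^(2l+1) extensions.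
   Only cycles in which both vertices at distance two from v are not special
   with v matter. There are at most x^2 (D^2 - s x^2) / 2 of them for l = 0,
   whose contribution x^4 - s, after division by beta, exactly compensates the
   s special clashes, and at most D^(2l+2) x^2 / 2 of them for l > 0, which
   gives a geometric series of ratio 4 / x^2. Hence k >= 3/2 x^4 + x^3 + 4 x^4
   / (x^2 - 4) colors suffice. *)
Require Import Defs.
From HB Require Import structures.
From mathcomp Require Import all_boot all_order all_algebra.
From mathcomp Require Import all_classical all_reals all_analysis.
From mathcomp Require Import zify ring lra.
Set Implicit Arguments. Unset Strict Implicit. Unset Printing Implicit Defensive.
Import Order.TTheory GRing.Theory Num.Theory.

(** * Counting walks and cycles through a vertex *)

Lemma card_tuple_rcons (T : finType) n (P : pred (seq T)) :
  #|[set p : n.+1.-tuple T | P p]| <=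
    \sum_(q : n.-tuple T) #|[set y | P (rcons q y)]|.
Proof.
pose A := [set qy : n.-tuple T * T | P (rcons qy.1 qy.2)].
pose f (qy : n.-tuple T * T) := [tuple of rcons qy.1 qy.2].
have sub : [set p : n.+1.-tuple T | P p] \subset f @: A.
  apply/fintype.subsetP => -[s szs]; rewrite inE /= => Ps.
  case/lastP: s szs Ps => [//|s y] szs Ps.
  have szs' : size s == n by move: szs; rewrite size_rcons eqSS.
  by apply/imsetP; exists (Tuple szs', y); [rewrite inE | apply: val_inj].
apply: leq_trans (subset_leq_card sub) _.
apply: leq_trans (leq_imset_card _ _) _.
under eq_bigr do rewrite -sum1_card.
rewrite -sum1_card pair_big_dep /=.
by rewrite [leqRHS](eq_bigl (mem A)) // => -[q y]; rewrite !inE.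
Qed.

Lemma sum_card_le_mul (I J : finType) (A : {set I}) (m : nat) (B : I -> {set J}) :
  (forall i, i \in A -> #|B i| <= m) -> \sum_(i in A) #|B i| <= #|A| * m.
Proof. by move=> h; rewrite -sum_nat_const; apply: leq_sum. Qed.

Section Walks.

Variables (T : finType) (e : rel T).
Hypothesis sym : symmetric e.

Definition codeg (u v : T) : nat := #|[set x | e u x && e v x]|.

Lemma codegC u v : codeg u v = codeg v u.
Proof. by apply: eq_card => x; rewrite !inE andbC. Qed.

Lemma deg_le_max_deg v : deg e v <= max_deg e.
Proof. exact: leq_bigmax. Qed.

Lemma card_walks v n :
  #|[set p : n.-tuple T | path e v p]| <= max_deg e ^ n.
Proof.
elim: n => [|n IHn].
  by rewrite expn0; apply: leq_trans (max_card _) _; rewrite card_tuple expn0.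
apply: leq_trans (@card_tuple_rcons T n (path e v)) _.
apply: leq_trans (_ : \sum_(q in [set p : n.-tuple T | path e v p]) max_deg e <= _).
  rewrite [leqRHS]big_mkcond /=; apply: leq_sum => q _; rewrite inE.
  case: ifPn => pq.
    apply: leq_trans (deg_le_max_deg (last v q)).
    by apply: subset_leq_card; apply/fintype.subsetP => y; rewrite !inE rcons_path => /andP[].
  by rewrite leqn0 cards_eq0; apply/eqP/setP => y; rewrite !inE rcons_path (negPf pq).
by rewrite sum_nat_const expnSr leq_mul2r IHn orbT.
Qed.

(** Double counting of the walks [v], [x], [u]: at most [max_deg e] choices for [x], then as many
    for [u]. *)
Lemma sum_codeg v : \sum_(u | u != v) codeg v u <= max_deg e ^ 2.
Proof.
apply: leq_trans (_ : \sum_u codeg v u <= _).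
  by rewrite big_mkcond /=; apply: leq_sum => u _; case: ifP.
under eq_bigr do rewrite /codeg -sum1_card big_mkcond /=.
rewrite exchange_big /=.
apply: leq_trans (_ : \sum_(x in [set x | e v x]) deg e x <= _).
  rewrite [leqRHS]big_mkcond /=; apply: leq_sum => x _; rewrite inE.
  case: ifPn => evx; last by rewrite big1 // => u _; rewrite inE (negPf evx).
  rewrite /deg -sum1_card [leqRHS]big_mkcond /=; apply: leq_sum => u _.
  by rewrite !inE evx sym.
apply: leq_trans (sum_card_le_mul (fun x _ => deg_le_max_deg x)) _.
by rewrite expnS expn1 leq_mul2r deg_le_max_deg orbT.
Qed.

Lemma cycle_cons_rev v (p : seq T) : cycle e (v :: rev p) = cycle e (v :: p).
Proof.
rewrite -(rotr_cycle 1) -(rev_cycle _ (v :: p)) rev_cons.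
have -> : v :: rev p = rotr 1 (rcons (rev p) v) by rewrite rotr1_rcons.
by rewrite !rotr_cycle; apply: eq_cycle => x y; rewrite sym.
Qed.

Variable sp : rel T.
Hypothesis sp_sym : symmetric sp.

(** For [p] of size 2l+3 the cycle [v :: p] has length 2l+4, and positions 1 and 2l+1 of [p] hold
    the two vertices at distance two from [v] along it. They coincide when l = 0. *)
Definition pointed_cycle (v : T) (l : nat) (p : seq T) :=
  [&& cycle e (v :: p), uniq (v :: p), ~~ sp v (nth v p 1)
    & ~~ sp v (nth v p l.*2.+1)].

Lemma pointed_cycle_rev v l (p : seq T) : size p = l.*2.+3 ->
  pointed_cycle v l (rev p) = pointed_cycle v l p.
Proof.
move=> szp; rewrite /pointed_cycle.
have -> : nth v (rev p) 1 = nth v p l.*2.+1.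
  by rewrite nth_rev szp // !subSS subn0.
have -> : nth v (rev p) l.*2.+1 = nth v p 1.
  by rewrite nth_rev szp ?ltnS // -(addn1 l.*2.+2) -(addn1 l.*2.+1) addKn.
rewrite !cons_uniq mem_rev rev_uniq.
rewrite cycle_cons_rev.
by case: (cycle _ _) => //=; case: (_ \notin _) => //=; case: (uniq p) => //=; rewrite andbC.
Qed.

Definition pointed_cycles v l :=
  [set p : (l.*2.+3).-tuple T | pointed_cycle v l p].

(** Of the two traversals of a cycle from [v], keeps the one whose first neighbor of [v] has smaller
    rank than the last. *)
Definition oriented_cycles v l :=
  [set p in pointed_cycles v l |
    enum_rank (nth v p 0) < enum_rank (nth v p l.*2.+2)].

(** Reversal sends oriented cycles injectively to pointed cycles with the opposite rank comparison,
    hence to a disjoint set. *)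
Lemma card_oriented_cycles v l :
  2 * #|oriented_cycles v l| <= #|pointed_cycles v l|.
Proof.
pose r (p : (l.*2.+3).-tuple T) := [tuple of rev p].
have r_inj : injective r.
  by move=> p q /(congr1 val) /= /(congr1 rev); rewrite !revK; apply: val_inj.
rewrite mul2n -addnn -{2}(card_imset _ r_inj) -cardsUI.
rewrite (_ : _ :&: _ = finset.set0) ?cards0 ?addn0.
  apply: subset_leq_card; rewrite finset.subUset; apply/andP; split.
    by apply/fintype.subsetP => p; rewrite inE => /andP[].
  apply/fintype.subsetP => _ /imsetP[p + ->]; rewrite !inE => /andP[pc _].
  by rewrite pointed_cycle_rev ?size_tuple.
apply/setP => p; rewrite !inE; apply/negP => /andP[/andP[_ lt1]].
case/imsetP => q; rewrite !inE => /andP[_ lt2] defp.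
move: lt1; rewrite defp /= !nth_rev ?size_tuple //.
by rewrite subnn subn1 /= ltnNge (ltnW lt2).
Qed.

(** A 4-cycle through [v] is given by the opposite vertex [u] and an ordered pair of common
    neighbors of [u] and [v]. *)
Lemma card_pointed_cycles0 v : #|pointed_cycles v 0| <=
  \sum_(u | (u != v) && ~~ sp v u) codeg v u ^ 2.
Proof.
pose A := [set a : T * (T * T) | [&& a.1 != v, ~~ sp v a.1,
   a.2.1 \in [set x | e v x && e a.1 x] & a.2.2 \in [set x | e v x && e a.1 x]]].
pose f (a : T * (T * T)) := [tuple a.2.1; a.1; a.2.2].
apply: leq_trans (_ : #|f @: A| <= _).
  apply: subset_leq_card; apply/fintype.subsetP => p; rewrite inE.
  case: p => -[|x [|u [|y [|]]]] //= szp.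
  rewrite /pointed_cycle /= !inE => /and4P[/and4P[evx exu euy /andP[eyv _]] uq spu _].
  apply/imsetP; exists (u, (x, y)); last by apply: val_inj.
  rewrite !inE /= spu evx euy (sym u x) exu (sym v y) eyv /= !andbT.
  by move: uq; rewrite /= !negb_or; case: (v =P u) => [->|/eqP]; rewrite ?eqxx ?andbF // eq_sym.
apply: leq_trans (leq_imset_card _ _) _.
rewrite -sum1_card.
rewrite [leqLHS](eq_bigl (fun a : T * (T * T) => ((a.1 != v) && ~~ sp v a.1) &&
  ((a.2.1 \in [set x | e v x && e a.1 x]) && (a.2.2 \in [set x | e v x && e a.1 x])))); last first.
  by move=> a; rewrite !inE !andbA.
rewrite -(pair_big_dep (fun u => (u != v) && ~~ sp v u)
  (fun u xy => (xy.1 \in [set x | e v x && e u x]) && (xy.2 \in [set x | e v x && e u x]))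
  (fun _ _ => 1)) /=.
apply: leq_sum => u _.
rewrite -(pair_big_dep (fun x => x \in [set x | e v x && e u x])
  (fun _ y => y \in [set x | e v x && e u x]) (fun _ _ => 1)) /=.
by rewrite !sum1_card sum_nat_const.
Qed.

(** Dropping the last vertex of [p] leaves a walk [q] from [v]; the dropped vertex is a common
    neighbor of [v] and the end of [q], which is one of the two vertices at distance two. *)
Lemma card_pointed_cycles v l : #|pointed_cycles v l| <=
  \sum_(q : (l.*2.+2).-tuple T |
      [&& path e v q, last v q != v & ~~ sp v (last v q)]) codeg v (last v q).
Proof.
apply: leq_trans (@card_tuple_rcons T _ (pointed_cycle v l)) _.
rewrite [leqRHS]big_mkcond /=; apply: leq_sum => q _.
have nth_q y : nth v (rcons q y) l.*2.+1 = last v q.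
  by rewrite nth_rcons size_tuple leqnn -nth_last size_tuple.
case: ifPn => [_|hq]; last first.
  rewrite leqn0 cards_eq0; apply/eqP/setP => y; rewrite !inE.
  apply/negbTE; apply: contra hq; rewrite /pointed_cycle nth_q.
  case/and4P => /=; rewrite rcons_path rcons_path => /andP[/andP[-> _] _].
  case/andP => vq _ _ ->; rewrite andbT /=.
  apply: contra vq => /eqP {1}<-; rewrite mem_rcons inE.
  case: (tval q) (size_tuple q) => //= a s _.
  by rewrite mem_last orbT.
apply: subset_leq_card; apply/fintype.subsetP => y; rewrite !inE /pointed_cycle /=.
case/and4P; rewrite rcons_path rcons_path last_rcons => /andP[/andP[_ ->] eyv] _ _ _.
by rewrite sym eyv.
Qed.

End Walks.

(** * Valid partial colorings, and how an extension by one vertex can fail *)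

Lemma card_bigcup_le (I J : finType) (P : pred I) (B : I -> {set J}) :
  #|\bigcup_(i | P i) B i| <= \sum_(i | P i) #|B i|.
Proof.
elim/big_rec2: _ => [|i m U _ leUm]; first by rewrite cards0.
by apply: leq_trans (leq_card_setU _ _) _; rewrite leq_add2l.
Qed.

Section PartialColorings.

Variables (T : finType) (e sp : rel T) (k : nat).
Hypotheses (sym : symmetric e) (irr : irreflexive e).
Hypotheses (sp_sym : symmetric sp) (sp_irr : irreflexive sp).

Definition conflict : rel T := [rel x y | e x y || sp x y].

Lemma conflictC x y : conflict x y = conflict y x.
Proof. by rewrite /conflict /= sym sp_sym. Qed.

Definition partial_coloring := {ffun T -> option 'I_k}.
Implicit Types (c : partial_coloring) (S : {set T}).

Definition colored c : {set T} := [set x | c x != None].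

Definition within2 c (a b : 'I_k) (p : seq T) :=
  all (fun x => (c x == Some a) || (c x == Some b)) p.

(** An uncolored vertex, of value [None], differs from every colored one, and a cycle through it is
    never [within2]; so only colored vertices are constrained. *)
Definition valid c : Prop :=
  (forall x y, conflict x y -> c x != None -> c x != c y) /\
  (forall p, is_graph_cycle e p -> forall a b, ~~ within2 c a b p).

Definition valid_on S := [set c | (colored c == S) && `[< valid c >]].

Definition restr S c : partial_coloring :=
  [ffun x => if x \in S then c x else None].

Lemma colored_restr S c : colored (restr S c) = S :&: colored c.
Proof. by apply/setP => x; rewrite !inE ffunE; case: (x \in S). Qed.

Lemma restr_restr S S' c : restr S (restr S' c) = restr (S :&: S') c.
Proof.
by apply/ffunP => x; rewrite !ffunE inE; case: (x \in S); case: (x \in S').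
Qed.

Lemma valid_restr S c : valid c -> valid (restr S c).
Proof.
move=> [prop acyc]; split=> [x y rxy|p cp a b].
  rewrite !ffunE; case: ifP => // _ cx.
  by case: ifP => // _; apply: prop.
apply: contra (acyc p cp a b); apply: sub_all => x.
by rewrite ffunE; case: ifP.
Qed.

Lemma restr_valid_on S S' c :
  c \in valid_on S -> restr S' c \in valid_on (S' :&: S).
Proof.
rewrite !inE => /andP[/eqP <- /asboolP vc].
by rewrite colored_restr eqxx; apply/asboolP; apply: valid_restr.
Qed.

Lemma valid_on0 : 0 < #|valid_on finset.set0|.
Proof.
apply/card_gt0P; exists [ffun => None]; rewrite inE; apply/andP; split.
  by apply/eqP/setP => x; rewrite !inE ffunE.
apply/asboolP; split=> [x y _|p /and3P[_ sz _] a b]; first by rewrite ffunE.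
by case: p sz => // x p _; rewrite /within2 /= ffunE.
Qed.

(** The color of [v] is arbitrary here; only the coloring of [S] has to be valid. *)
Definition extensions v S :=
  [set c | (colored c == v |: S) && (restr S c \in valid_on S)].

Lemma card_extensions v S : v \notin S ->
  k * #|valid_on S| <= #|extensions v S|.
Proof.
move=> vS; pose f (ac : 'I_k * partial_coloring) : partial_coloring :=
  [ffun x => if x == v then Some ac.1 else ac.2 x].
have valid_v c : c \in valid_on S -> c v = None.
  rewrite inE => /andP[/eqP defS _]; apply/eqP; rewrite -[_ == _]negbK.
  by apply: contra vS; rewrite -defS inE.
have -> : k * #|valid_on S| = #|f @: finset.setX [set: 'I_k] (valid_on S)|.
  rewrite card_in_imset ?cardsX ?cardsT ?card_ord //.
  move=> [a c] [a' c']; rewrite !inE /= => vc vc' /ffunP eqf.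
  have := eqf v; rewrite !ffunE eqxx => -[->]; congr pair; apply/ffunP => x.
  have := eqf x; rewrite !ffunE; case: eqP => // -> _.
  by rewrite !valid_v ?inE.
apply: subset_leq_card; apply/fintype.subsetP => _ /imsetP[[a c] + ->].
rewrite finset.in_setX => /andP[_ /= vc].
have defS : colored c = S by move: vc; rewrite inE => /andP[/eqP].
have frestr : restr S (f (a, c)) = c.
  apply/ffunP => x; rewrite !ffunE; case: ifPn => [xS|].
    by case: eqP xS vS => // -> ->.
  by rewrite -defS inE negbK => /eqP.
rewrite inE frestr vc andbT; apply/eqP/setP => x; rewrite !inE ffunE.
by case: (x == v); rewrite //= -defS inE.
Qed.

Lemma extensions_out v S c x :
  c \in extensions v S -> x \notin v |: S -> c x = None.
Proof. by rewrite inE => /andP[/eqP <- _]; rewrite inE negbK => /eqP. Qed.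

Lemma extensions_in v S c x :
  c \in extensions v S -> (x \in v |: S) = (c x != None).
Proof. by rewrite inE => /andP[/eqP <- _]; rewrite inE. Qed.

Definition clashing v S u := [set c in extensions v S | c v == c u].

(** The restriction to [S] loses nothing: the color of [v] is read off at [u]. *)
Lemma card_clashing v S u : u != v -> #|clashing v S u| <= #|valid_on S|.
Proof.
move=> uv; have inj : {in clashing v S u &, injective (restr S)}.
  move=> c c' /finset.setIdP[ec /eqP cv] /finset.setIdP[ec' /eqP cv'] /ffunP eqr.
  have eqx x : x != v -> c x = c' x.
    move=> xv; have := eqr x; rewrite !ffunE; case: ifPn => // xS _.
    by rewrite !(extensions_out (v := v) (S := S)) // !inE negb_or xv.
  apply/ffunP => x; case: (eqVneq x v) => [->|/eqx//].
  by rewrite cv cv' eqx.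
rewrite -(card_in_imset inj); apply: subset_leq_card.
apply/fintype.subsetP => _ /imsetP[c + ->].
by rewrite inE => /andP[]; rewrite inE => /andP[].
Qed.

Definition alternating c v p :=
  [forall i : 'I_(size p).-1, c (nth v (v :: p) i.+2) == c (nth v (v :: p) i)].

Lemma alternatingP c v p : reflect
  (forall i, i.+2 <= size p -> c (nth v (v :: p) i.+2) = c (nth v (v :: p) i))
  (alternating c v p).
Proof.
apply: (iffP forallP) => [h i lti|h i].
  have lti' : i < (size p).-1 by lia.
  exact/eqP/(h (Ordinal lti')).
by apply/eqP/h; have := ltn_ord i; lia.
Qed.

Lemma alternating_nth c v p i : alternating c v p -> i <= size p ->
  c (nth v (v :: p) i) = c (nth v (v :: p) (odd i)).
Proof.
move=> /alternatingP alt; elim/ltn_ind: i => -[|[|i]] IHi //.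
by move=> lti; rewrite alt // IHi ?(ltnW (ltnW lti)) // [odd i.+2]/= negbK.
Qed.

Definition alternating_on v S p :=
  [set c in extensions v S | all (mem (v |: S)) p && alternating c v p].

Definition tail_set (p : seq T) : {set T} := [set x in drop 2 p].

(** The first two vertices of [p] keep their colors and, by alternation, determine those of [v] and
    of all of [tail_set p]. So [v] and [tail_set p] can be uncolored without loss of information. *)
Lemma card_alternating_on v S p : 2 <= size p -> uniq (v :: p) ->
  #|alternating_on v S p| <= #|valid_on (S :\: tail_set p)|.
Proof.
case: p => [|x [|y p]] // _ uvp.
have [xv yv] : x != v /\ y != v.
  by move: uvp => /= /andP[]; rewrite !inE !negb_or => /and3P[vx vy _] _; rewrite ![_ == v]eq_sym.
have [xp yp] : x \notin p /\ y \notin p.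
  by move: uvp => /= /and4P[_]; rewrite !inE negb_or => /andP[_ ->] ->.
set q := [:: x, y & p] in uvp *.
pose W := tail_set q.
have inj : {in alternating_on v S q &, injective (restr (S :\: W))}.
  move=> c c' /finset.setIdP[ec /andP[/allP cS alt]].
  move=> /finset.setIdP[ec' /andP[/allP cS' alt']] /ffunP eqr.
  have eqx z : z != v -> z \notin p -> c z = c' z.
    move=> zv zp; have := eqr z; rewrite !ffunE !inE /q /= drop0 zp /=.
    case: ifPn => // zS _.
    by rewrite !(extensions_out (v := v) (S := S)) // !inE negb_or zv.
  have eqq i : i <= size q -> c (nth v (v :: q) i) = c' (nth v (v :: q) i).
    move=> ltiq; rewrite (alternating_nth alt) // (alternating_nth alt') //.
    have [alty alty'] := ((alternatingP _ _ _ alt) 0 isT, (alternatingP _ _ _ alt') 0 isT).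
    case: (odd i) => /=; first exact: eqx.
    by move: alty alty' => /= <- <-; apply: eqx.
  apply/ffunP => z; case: (boolP (z \in v :: q)) => [zq|].
    have := eqq (index z (v :: q)); rewrite nth_index //; apply.
    by rewrite -ltnS -[(size q).+1]/(size (v :: q)) index_mem.
  by rewrite !inE !negb_or => /and4P[zv _ _ zp]; apply: eqx.
rewrite -(card_in_imset inj); apply: subset_leq_card.
apply/fintype.subsetP => _ /imsetP[c + ->] => /finset.setIdP[].
rewrite inE => /andP[_ vc] _.
(* Validity is known only for [restr S c], so the restriction is made to pass through it. *)
have -> : restr (S :\: W) c = restr (S :\: W) (restr S c).
  rewrite restr_restr; congr restr; apply/setP => z; rewrite !inE.
  by case: (z \in S); rewrite ?andbT ?andbF.
have {2}-> : S :\: tail_set q = (S :\: W) :&: S.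
  by apply/setP => z; rewrite !inE; case: (z \in S); rewrite ?andbT ?andbF.
exact: restr_valid_on.
Qed.

Definition bad_on v S : {set partial_coloring} :=
  (\bigcup_(u | conflict v u) clashing v S u) :|:
  \bigcup_(l < #|T|) \bigcup_(p in oriented_cycles e sp v l) alternating_on v S p.

Section ExtensionBad.

Variables (v : T) (S : {set T}) (c : partial_coloring).
Hypothesis (ec : c \in extensions v S).
Hypothesis noclash : forall u, conflict v u -> c v != c u.

Lemma extension_proper x y : conflict x y -> c x != None -> c x != c y.
Proof.
move=> rxy cx; have xvS := cx; rewrite -(extensions_in x ec) in xvS.
have [cy|cy] := eqVneq (c y) None; first by rewrite cy.
have yvS := cy; rewrite -(extensions_in y ec) in yvS.
case: (eqVneq x v) rxy xvS => [->|xv] rxy xvS; first exact: noclash.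
case: (eqVneq y v) rxy yvS => [->|yv] rxy yvS.
  by rewrite eq_sym; apply: noclash; rewrite conflictC.
move: xvS yvS; rewrite !inE (negPf xv) (negPf yv) /= => xS yS.
move: ec; rewrite inE => /andP[_]; rewrite inE => /andP[_ /asboolP[prop _]].
by have := prop x y rxy; rewrite !ffunE xS yS; apply.
Qed.

Lemma within2_alternating a b p : cycle e (v :: p) -> 2 <= size p ->
  within2 c a b (v :: p) -> odd (size p) /\ alternating c v p.
Proof.
move=> cp szp wp.
have w i : i <= size p ->
    (c (nth v (v :: p) i) == Some a) || (c (nth v (v :: p) i) == Some b).
  by move=> lti; apply: (allP wp); apply: mem_nth.
have ncol i : i <= size p -> c (nth v (v :: p) i) != None.
  by move/w; case/orP => /eqP ->.
have ee i : i < size p -> c (nth v (v :: p) i) != c (nth v (v :: p) i.+1).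
  move=> lti; apply: extension_proper; last by apply: ncol; apply: ltnW.
  apply/orP; left; move: cp; rewrite /= rcons_path => /andP[/pathP pp _].
  exact: pp.
have alt : alternating c v p.
  apply/alternatingP => i lti.
  (* With two colors available and consecutive vertices different, vertices two steps apart
     agree. *)
  have := (w i.+2 lti, w i.+1 (ltnW lti), w i (ltnW (ltnW lti)), ee i (ltnW lti), ee i.+1 lti).
  case=> -[[[/orP[] /eqP -> /orP[] /eqP -> /orP[] /eqP ->]]] //; by rewrite ?eqxx.
(* Were [size p] even, alternation would give the last vertex the color of its neighbor [v]. *)
split=> //; have : c (nth v (v :: p) (size p)) != c v.
  apply: extension_proper; last exact: ncol.
  apply/orP; left; move: cp; rewrite /= rcons_path => /andP[_].
  by rewrite (last_nth v).
by rewrite alternating_nth //; case: (odd _); rewrite //= eqxx.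
Qed.

Lemma within2_bad a b p : cycle e (v :: p) -> 2 <= size p ->
  uniq (v :: p) -> within2 c a b (v :: p) ->
  enum_rank (nth v p 0) < enum_rank (nth v p (size p).-1) -> c \in bad_on v S.
Proof.
move=> cp szp uvp wp ltr; have [oddp alt] := within2_alternating cp szp wp.
pose l := (size p - 3)./2.
have szl : size p = l.*2.+3.
  by rewrite /l; have := odd_double_half (size p); rewrite oddp; lia.
have ltl : l < #|T|.
  have : size (v :: p) <= #|T| by rewrite -(card_uniqP uvp) max_card.
  by rewrite /= szl -addnn; lia.
(* Vertices at even positions share the color of [v], so being special with [v] would make them
   clash. *)
have nsp i : ~~ odd i -> 0 < i -> i <= size p -> ~~ sp v (nth v (v :: p) i).
  move=> evi i0 lti; apply/negP => spi.
  have := noclash (u := nth v (v :: p) i); rewrite /conflict /= spi orbT => /(_ isT).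
  by rewrite (alternating_nth alt) // (negPf evi) /= eqxx.
have szp' : size p == l.*2.+3 by rewrite szl.
rewrite inE; apply/orP; right; apply/bigcupP; exists (Ordinal ltl) => //.
apply/bigcupP; exists (Tuple szp').
  rewrite inE; apply/andP; split; last by move: ltr; rewrite szl.
  rewrite inE /pointed_cycle cp uvp /=.
  apply/andP; split; first by apply: (nsp 2).
  by apply: (nsp l.*2.+2); rewrite ?szl //= ?odd_double.
rewrite inE ec alt andbT /=; apply/allP => x xp /=.
rewrite (extensions_in x ec).
by have /orP[]:= allP wp x (mem_behead (s := v :: p) xp) => /eqP ->.
Qed.

End ExtensionBad.

(** Without a clash at [v], an invalid extension has a bicolored cycle. It must pass through [v],
    and starting it at [v] in the right direction makes it an oriented cycle. *)
Lemma extensions_subset v S : v \notin S ->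
  extensions v S \subset valid_on (v |: S) :|: bad_on v S.
Proof.
move=> vS; apply/fintype.subsetP => c ec; rewrite inE.
case: (boolP (c \in valid_on _)) => //= nvalid.
case: (boolP (c \in \bigcup_(u | conflict v u) clashing v S u)) => [cl|ncl].
  by rewrite inE cl.
have noclash u : conflict v u -> c v != c u.
  move=> rvu; apply: contra ncl => cvu; apply/bigcupP; exists u => //.
  by rewrite inE ec.
have [p [a [b [cp wp]]]] : exists p a b, is_graph_cycle e p /\ within2 c a b p.
  apply: contrapT => nex; move/negP: nvalid; apply; rewrite inE.
  have -> : colored c == v |: S by move: ec; rewrite inE => /andP[].
  apply/asboolP; split; first exact: extension_proper ec noclash.
  by move=> p cp a b; apply/negP => wp; apply: nex; exists p, a, b.
(* A bicolored cycle avoiding [v] would lie in [S], where the coloring is valid. *)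
have vp : v \in p.
  apply: contraT => vp; have := ec; rewrite inE => /andP[_].
  rewrite inE => /andP[_ /asboolP[_ /(_ p cp a b)]] /negP[].
  apply/allP => x xp; have := allP wp x xp; rewrite ffunE.
  suff -> : x \in S by [].
  have : x \in v |: S by rewrite (extensions_in x ec); have /orP[] := allP wp x xp => /eqP ->.
  by rewrite !inE; case: eqP xp vp => // -> ->.
have [i q defq] := rot_to vp.
move: cp => /and3P[up szp cp].
have {}cp : cycle e (v :: q) by rewrite -defq rot_cycle.
have {}up : uniq (v :: q) by rewrite -defq rot_uniq.
have {}szp : 2 <= size q by move: szp; rewrite -(size_rot i) defq.
have {}wp : within2 c a b (v :: q) by rewrite -defq /within2 (eq_all_r (mem_rot i p)).
have neq : enum_rank (nth v q 0) != enum_rank (nth v q (size q).-1).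
  rewrite (inj_eq enum_rank_inj) nth_uniq //; try lia.
  by move: up => /andP[].
(* The two neighbors of [v] on the cycle are compared by rank; in the wrong order, the cycle is
   reversed. *)
case: (ltngtP (enum_rank (nth v q 0)) (enum_rank (nth v q (size q).-1))) => [lt|lt|/val_inj/eqP].
- refine (within2_bad ec noclash cp szp up wp lt).
- apply: (within2_bad ec noclash (p := rev q) (a := a) (b := b)).
  + by rewrite cycle_cons_rev.
  + by rewrite size_rev.
  + by move: up => /=; rewrite mem_rev rev_uniq.
  + by move: wp; rewrite /within2 /= all_rev.
  + have q0 : 0 < size q := ltnW szp.
    by rewrite size_rev !nth_rev ?prednK // subn1 subnn.
- by rewrite (negPf neq).
Qed.

Lemma card_bad_on v S : v \notin S -> #|bad_on v S| <=
  #|[set u | conflict v u]| * #|valid_on S| +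
  \sum_(l < #|T|) \sum_(p in oriented_cycles e sp v l | all (mem S) p)
     #|valid_on (S :\: tail_set p)|.
Proof.
move=> vS; apply: leq_trans (leq_card_setU _ _) _; apply: leq_add.
  apply: leq_trans (card_bigcup_le _ _) _.
  rewrite -sum_nat_const big_mkcond [leqRHS]big_mkcond /=.
  apply: leq_sum => u _; rewrite finset.in_set; case: ifP => // rvu.
  apply: card_clashing; apply: contraTneq rvu => ->.
  by rewrite /conflict /= irr sp_irr.
apply: leq_trans (card_bigcup_le _ _) _; apply: leq_sum => l _.
apply: leq_trans (card_bigcup_le _ _) _.
rewrite [leqRHS]big_mkcondr /=; apply: leq_sum => p.
rewrite inE => /andP[]; rewrite inE => /and4P[_ up _ _] _.
case: ifPn => pS; first by apply: card_alternating_on => //; rewrite size_tuple.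
rewrite leqn0 cards_eq0; apply/eqP/setP => c; rewrite !inE.
apply/negP => /andP[_ /andP[/allP pvS _]]; move/negP: pS; apply.
apply/allP => x xp; have := pvS x xp; rewrite /= !inE.
by case: eqP xp => // -> vp; move: up; rewrite /= vp.
Qed.

Lemma card_valid_on_step v S : v \notin S ->
  k * #|valid_on S| <= #|valid_on (v |: S)| +
  (#|[set u | conflict v u]| * #|valid_on S| +
  \sum_(l < #|T|) \sum_(p in oriented_cycles e sp v l | all (mem S) p)
     #|valid_on (S :\: tail_set p)|).
Proof.
move=> vS; apply: leq_trans (card_extensions vS) _.
apply: leq_trans (subset_leq_card (extensions_subset vS)) _.
apply: leq_trans (leq_card_setU _ _) _.
by rewrite leq_add2l card_bad_on.
Qed.

Lemma valid_on_colorable : 0 < #|valid_on [set: T]| -> acyclic_colorable e k.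
Proof.
case/card_gt0P => c; rewrite inE => /andP[/eqP cT /asboolP[prop acyc]].
have col x : {a | c x = Some a}.
  have : x \in colored c by rewrite cT inE.
  by rewrite inE; case: (c x) => // a _; exists a.
pose f x := sval (col x); have fE x : c x = Some (f x) := svalP (col x).
exists f; split=> [x y exy|p cp [a [b /allP wp]]].
  have := prop x y; rewrite /conflict /= exy !fE => /(_ isT isT).
  by apply: contra => /eqP ->.
by have /negP[] := acyc p cp a b; apply/allP => x /wp; rewrite fE.
Qed.

End PartialColorings.

Local Open Scope ring_scope.

(** * Growth of the number of valid colorings *)

Section Counting.

Variables (R : realFieldType) (T : finType) (e sp : rel T) (k : nat).
Hypotheses (sym : symmetric e) (irr : irreflexive e).
Hypotheses (sp_sym : symmetric sp) (sp_irr : irreflexive sp).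
Variable beta : R.
Hypothesis beta_gt0 : 0 < beta.

Local Notation F S := (#|valid_on e sp k S|%:R : R).

(** The vertices of [W] are put back one at a time, each gaining a factor [beta]. Growth is assumed
    only from sets of fewer than [n] elements, so that it can be supplied by the induction
    hypothesis of [valid_on_grow]. *)
Lemma valid_on_erase n (S W : {set T}) :
  (forall (S' : {set T}) v, (#|S'| < n)%N -> v \notin S' -> beta * F S' <= F (v |: S')) ->
  (#|S| <= n)%N -> W \subset S -> beta ^+ #|W| * F (S :\: W) <= F S.
Proof.
move=> step Sn; move: {2}#|W| (erefl #|W|) => m.
elim: m W => [|m IHm] W cardW WS.
  by rewrite (cards0_eq cardW) cards0 expr0 mul1r finset.setD0.
have /card_gt0P[w wW] : (0 < #|W|)%N by rewrite cardW.
have wS : w \in S := fintype.subsetP WS w wW.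
have cardW' : #|W :\ w| = m by have := cardsD1 w W; rewrite wW cardW; case.
have W'S : W :\ w \subset S by apply: fintype.subset_trans (subsetDl _ _) WS.
apply: le_trans (IHm _ cardW' W'S).
rewrite cardW' cardW exprSr -mulrA ler_wpM2l ?exprn_ge0 ?(ltW beta_gt0) //.
have -> : S :\: (W :\ w) = w |: (S :\: W).
  apply/setP => x; rewrite !inE; case: eqP => [->|] //=; by rewrite wS.
apply: step; last by rewrite !inE wW.
apply: leq_trans Sn; apply: proper_card; apply/properP; split.
  exact: subsetDl.
by exists w => //; rewrite !inE wW.
Qed.

(** The terms on the left pay for the growth factor, the clashes at [v], and the bicolored cycles
    through [v]; the exponent 2l+1 is the size of [tail_set]. *)
Hypothesis budget : forall v,
  beta + #|[set u | conflict e sp v u]|%:R +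
  \sum_(l < #|T|) #|oriented_cycles e sp v l|%:R / beta ^+ l.*2.+1 <= k%:R.

Lemma valid_on_grow (S : {set T}) v : v \notin S -> beta * F S <= F (v |: S).
Proof.
move: {2}#|S|.+1 (ltnSn #|S|) => n; elim: n S v => [|n IHn] // S v Sn vS.
have erase (W : {set T}) : W \subset S -> F (S :\: W) <= F S / beta ^+ #|W|.
  move=> WS; rewrite ler_pdivlMr ?exprn_gt0 // mulrC.
  exact: valid_on_erase IHn Sn WS.
have := card_valid_on_step k sym irr sp_sym sp_irr vS.
rewrite -(ler_nat R) !natrD !natrM natr_sum => hk.
have cyc : \sum_(l < #|T|) (\sum_(p in oriented_cycles e sp v l | all (mem S) p)
      #|valid_on e sp k (S :\: tail_set p)|)%N%:R <=
    (\sum_(l < #|T|) #|oriented_cycles e sp v l|%:R / beta ^+ l.*2.+1) * F S.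
  rewrite mulr_suml; apply: ler_sum => l _; rewrite natr_sum.
  apply: le_trans (_ : \sum_(p in oriented_cycles e sp v l) F S / beta ^+ l.*2.+1 <= _).
    rewrite big_mkcondr; apply: ler_sum => p.
    rewrite inE => /andP[]; rewrite inE => /and4P[_ /andP[_ up] _ _] _.
    case: ifPn => [/allP pS|_]; last by rewrite divr_ge0 ?exprn_ge0 // ltW.
    have cardW : #|tail_set p| = l.*2.+1.
      rewrite /tail_set cardsE (card_uniqP (drop_uniq _ up)) size_drop size_tuple.
      by rewrite !subSS subn0.
    have := erase (tail_set p); rewrite cardW; apply.
    by apply/fintype.subsetP => x; rewrite inE => /mem_drop /pS.
  by rewrite sumr_const -[leLHS]mulr_natl mulrA [leRHS]mulrAC.
(* The budget times [F S], set against the lower bound on extensions in [hk], leaves at least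
   [beta * F S] valid ones. *)
have bud := ler_wpM2r (ler0n R #|valid_on e sp k S|) (budget v).
move: bud; rewrite !mulrDl; lra.
Qed.

Lemma budget_colorable : acyclic_colorable e k.
Proof.
apply: (@valid_on_colorable T e sp); rewrite -(ltr0n R).
apply: lt_le_trans (_ : beta ^+ #|[set: T]| * F finset.set0 <= _).
  by rewrite mulr_gt0 ?exprn_gt0 // ltr0n valid_on0.
rewrite -(finset.setDv [set: T]).
apply: (@valid_on_erase #|[set: T]|) => // S' v _; exact: valid_on_grow.
Qed.

End Counting.

(** * Geometric series, and cycle counts when special means codegree above a threshold *)

Lemma sum_geometric_le (R : realFieldType) (q : R) n :
  0 <= q -> q < 1 -> \sum_(l < n) q ^+ l <= (1 - q)^-1.
Proof.
move=> q0 q1; rewrite -[leRHS]mul1r ler_pdivlMr ?subr_gt0 //.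
have := subrX1 q n; have := exprn_ge0 n q0.
move: (\sum_(l < n) _) (q ^+ n) => s a; lra.
Qed.

Section Threshold.

Variables (R : realFieldType) (T : finType) (e : rel T).
Hypothesis sym : symmetric e.
Variable t : R.
Hypothesis t_ge0 : 0 <= t.

Definition special : rel T := [rel u v | (u != v) && (t < (codeg e u v)%:R)].

Lemma special_sym : symmetric special.
Proof. by move=> u v; rewrite /special /= eq_sym codegC. Qed.

Lemma special_irr : irreflexive special.
Proof. by move=> u; rewrite /special /= eqxx. Qed.

Local Notation D := ((max_deg e)%:R : R).

Lemma card_conflict v : (#|[set u | conflict e special v u]|%:R : R) <=
  D + #|[set u | special v u]|%:R.
Proof.
rewrite -natrD ler_nat.
have -> : [set u | conflict e special v u] = [set u | e v u] :|: [set u | special v u].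
  by apply/setP => u; rewrite !inE.
by apply: leq_trans (leq_card_setU _ _) _; rewrite leq_add2r deg_le_max_deg.
Qed.

(** For non-special [u] the squared codegree is at most [t] times the codegree, and each special
    vertex takes at least [t] out of the total codegree, itself at most D^2. *)
Lemma card_oriented_cycles0 v : (#|oriented_cycles e special v 0%N|%:R : R) <=
  t * (D ^+ 2 - #|[set u | special v u]|%:R * t) / 2.
Proof.
rewrite ler_pdivlMr // mulrC -natrM.
apply: le_trans (_ : (#|pointed_cycles e special v 0%N|%:R : R) <= _).
  by rewrite ler_nat; apply: card_oriented_cycles.
apply: le_trans (_ : (\sum_(u | (u != v) && ~~ special v u) codeg e v u ^ 2)%:R <= _).
  by rewrite ler_nat; apply: card_pointed_cycles0.
rewrite natr_sum.
apply: le_trans (_ : t * \sum_(u | (u != v) && ~~ special v u) (codeg e v u)%:R <= _).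
  rewrite mulr_sumr; apply: ler_sum => u /andP[uv]; rewrite /special /= eq_sym uv /= -leNgt => cu.
  by rewrite expnS expn1 natrM ler_wpM2r.
apply: ler_wpM2l => //; rewrite lerBrDr.
apply: le_trans (_ : (\sum_(u | u != v) codeg e v u)%:R <= _); last first.
  by rewrite -natrX ler_nat sum_codeg.
rewrite natr_sum [leRHS](bigID (special v)) addrC lerD2r.
apply: le_trans (_ : \sum_(u in [set u | special v u]) t <= _).
  by rewrite sumr_const mulr_natl.
rewrite big_mkcond [leRHS]big_mkcond /=; apply: ler_sum => u _; rewrite inE /special /= eq_sym.
by case: eqP => //= _; case: ltP => // /ltW.
Qed.

(** There are at most D^(2l+2) walks; each ends at a vertex not special with [v], which leaves at
    most [t] choices to close the cycle. *)
Lemma card_oriented_cyclesS v l : (#|oriented_cycles e special v l|%:R : R) <=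
  D ^+ l.*2.+2 * t / 2.
Proof.
rewrite ler_pdivlMr // mulrC -natrM.
apply: le_trans (_ : (#|pointed_cycles e special v l|%:R : R) <= _).
  by rewrite ler_nat; apply: card_oriented_cycles.
apply: le_trans (_ : (\sum_(q : (l.*2.+2).-tuple T |
      [&& path e v q, last v q != v & ~~ special v (last v q)]) codeg e v (last v q))%:R <= _).
  by rewrite ler_nat; apply: card_pointed_cycles.
rewrite natr_sum.
apply: le_trans (_ : \sum_(q in [set q : (l.*2.+2).-tuple T | path e v q]) t <= _).
  rewrite big_mkcond [leRHS]big_mkcond /=; apply: ler_sum => q _; rewrite inE.
  case: (path e v q) => //=; case: ifPn => // /andP[qv].
  by rewrite /special /= eq_sym qv /= -leNgt.
by rewrite sumr_const -[leLHS]mulr_natl ler_wpM2r // -natrX ler_nat card_walks.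
Qed.

End Threshold.

(** * Numerical bounds in terms of the cube root [x] of the maximum degree *)

Lemma long_cycle_weight (R : realFieldType) (x : R) i : x != 0 ->
  (x ^+ 3) ^+ i.+1.*2.+2 * x ^+ 2 / 2 =
  x ^+ 4 * (4 / x ^+ 2) * (4 / x ^+ 2) ^+ i * (x ^+ 4 / 2) ^+ i.+1.*2.+1.
Proof.
move=> xn0; rewrite -muln2 !expr_div_n -!exprM.
have -> : (3 * (i.+1 * 2).+2 = 2 * i * 3 + 12)%N by lia.
have -> : (4 * (i.+1 * 2).+1 = 2 * i * 4 + 12)%N by lia.
have -> : ((i.+1 * 2).+1 = 2 * i + 3)%N by lia.
have -> : 4 ^+ i = 2 ^+ (2 * i) :> R by rewrite exprM; congr (_ ^+ _); ring.
move: (2 * i)%N => m; rewrite !exprD !(exprM x m).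
have : x ^+ m != 0 by rewrite expf_neq0.
have : 2 ^+ m != 0 :> R by rewrite expf_neq0 // pnatr_eq0.
move: (x ^+ m) (2 ^+ m) => X P P0 X0.
by field; rewrite P0 X0 xn0.
Qed.

Lemma colorable_bound (R : realFieldType) (T : finType) (e : rel T) (x : R) k :
  symmetric e -> irreflexive e -> 2 < x -> x ^+ 3 = (max_deg e)%:R ->
  3 / 2 * x ^+ 4 + x ^+ 3 + 4 * x ^+ 4 / (x ^+ 2 - 4) <= k%:R ->
  acyclic_colorable e k.
Proof.
move=> sym irr x_gt2 x3 hk; pose t := x ^+ 2; pose beta := x ^+ 4 / 2.
have x0 : 0 < x by lra.
have beta0 : 0 < beta by rewrite divr_gt0 ?exprn_gt0.
have t0 : 0 <= t by rewrite exprn_ge0 ?ltW.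
have x24 : 0 < x ^+ 2 - 4.
  have -> : x ^+ 2 - 4 = (x - 2) * (x + 2) by ring.
  by rewrite mulr_gt0 //; lra.
apply: (budget_colorable sym irr (special_sym e t) (special_irr e t) beta0) => v.
set s := #|[set u | special e t v u]|%:R : R.
have xn0 : x != 0 by rewrite gt_eqF.
pose q := 4 / x ^+ 2.
have q0 : 0 <= q by rewrite divr_ge0 ?exprn_ge0 ?ltW.
have q1 : q < 1 by rewrite ltr_pdivrMr ?exprn_gt0 // mul1r -subr_gt0.
have conf := card_conflict e t v; rewrite -/s -x3 in conf.
case nT : #|T| => [|n]; first by have := max_card (pred1 v); rewrite card1 nT.
rewrite big_ord_recl /=.
(* The 4-cycle count x^2 (x^6 - s x^2) / 2 is exactly [beta] times x^4 - s. *)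
have c0 : #|oriented_cycles e (special e t) v 0%N|%:R / beta ^+ 1 <= x ^+ 4 - s.
  rewrite expr1 ler_pdivrMr //; apply: le_trans (card_oriented_cycles0 sym t0 v) _.
  by rewrite -/s -x3 /t /beta le_eqVlt; apply/orP; left; apply/eqP; field.
(* Index [i] stands for l = i + 1, whose term is at most x^4 q^l. *)
have cS : \sum_(i < n) #|oriented_cycles e (special e t) v (lift ord0 i)|%:R /
    beta ^+ (lift ord0 i).*2.+1 <= 4 * x ^+ 4 / (x ^+ 2 - 4).
  apply: le_trans (_ : \sum_(i < n) x ^+ 4 * q * q ^+ i <= _).
    apply: ler_sum => i _; rewrite ler_pdivrMr ?exprn_gt0 //.
    apply: le_trans (card_oriented_cyclesS sym t0 v _) _.
    by rewrite lift0 -x3 long_cycle_weight.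
  rewrite -mulr_sumr; apply: le_trans (ler_wpM2l _ (sum_geometric_le n q0 q1)) _.
    by rewrite mulr_ge0 ?exprn_ge0 ?(ltW x0).
  by rewrite /q le_eqVlt; apply/orP; left; apply/eqP; field; rewrite xn0 gt_eqF.
(* The [s] from the special clashes cancels against x^4 - s, and [beta] adds x^4 / 2, whence the
   coefficient 3/2. *)
move: conf c0 cS hk; rewrite /beta; lra.
Qed.

Theorem theorem1 (R : realType) (T : finType) (e : rel T)
    (sym : symmetric e) (irr : irreflexive e) :
  (24 <= max_deg e)%N ->
  let D : R := (max_deg e)%:R in
  (acyclic_chromatic irr)%:R <
    Order.min (3 / 2 * D `^ (4 / 3) + 5 * D - 14)
              (3 / 2 * D `^ (4 / 3) + D + 8 * D `^ (4 / 3) / (D `^ (2 / 3) - 4) + 1).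
Proof.
move=> D24; cbv zeta; set D : R := (max_deg e)%:R.
have D24R : 24 <= D by rewrite (ler_nat R 24).
pose x := D `^ (1 / 3).
have D0 : 0 <= D by lra.
have xX n : D `^ (n%:R / 3) = x ^+ n.
  by rewrite /x -powR_mulrn ?powR_ge0 // -powRrM; congr (_ `^ _); field.
have x3 : x ^+ 3 = D by rewrite -xX divff ?powRr1 // pnatr_eq0.
rewrite !xX -x3.
(* The assumption D >= 24 enters here: 2.88^3 is about 23.89. *)
have x288 : 288 / 100 < x.
  rewrite ltNge; apply/negP => xle.
  have : x ^+ 3 <= (288 / 100) ^+ 3 by rewrite lerXn2r ?nnegrE ?powR_ge0 ?divr_ge0.
  rewrite x3; lra.
have x24 : 0 < x ^+ 2 - 4.
  have -> : x ^+ 2 - 4 = (x - 2) * (x + 2) by ring.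
  by rewrite mulr_gt0 //; lra.
pose B := 3 / 2 * x ^+ 4 + x ^+ 3 + 4 * x ^+ 4 / (x ^+ 2 - 4).
have x0 : 0 < x by lra.
have y0 : 0 < 4 * x ^+ 4 / (x ^+ 2 - 4) by rewrite divr_gt0 // mulr_gt0 ?exprn_gt0.
have B0 : 0 <= B by rewrite /B; have := exprn_gt0 4 x0; have := exprn_gt0 3 x0; lra.
(* The least integer above [B]; rounding costs at most 1. *)
pose k := (Num.truncn B).+1.
have [k_lb k_ub] : B < k%:R /\ k%:R <= B + 1.
  have /andP[h1 h2] := truncn_itv B0; split=> //.
  by rewrite /k -natr1 lerD2r.
have colk : acyclic_colorable e k.
  apply: (colorable_bound sym irr _ x3 (ltW k_lb)); lra.
have chik : (acyclic_chromatic irr)%:R <= k%:R :> R.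
  rewrite ler_nat /acyclic_chromatic; case: ex_minnP => m _; apply.
  exact/asboolP.
apply: (le_lt_trans (le_trans chik k_ub)); rewrite lt_min; apply/andP; split.
  (* Exactly what B + 1 < 3/2 x^4 + 5 x^3 - 14 requires; 15 is 14 plus the 1 lost in rounding. *)
  have : 4 * x ^+ 4 / (x ^+ 2 - 4) < 4 * x ^+ 3 - 15.
    rewrite ltr_pdivrMr // -subr_gt0.
    have -> : (4 * x ^+ 3 - 15) * (x ^+ 2 - 4) - 4 * x ^+ 4 =
      x ^+ 2 * (x * (4 * x ^+ 2 - 4 * x - 16) - 15) + 60 by ring.
    (* At x = 2.88 the quadratic is about 5.66, and 2.88 times 28/5 exceeds 15. *)
    have h : 28 / 5 < 4 * x ^+ 2 - 4 * x - 16 by nra.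
    have g : 0 < x * (4 * x ^+ 2 - 4 * x - 16) - 15 by nra.
    by have := mulr_gt0 (exprn_gt0 2 x0) g; lra.
  rewrite /B; lra.
(* The second bound is B + 1 plus another copy of the positive term 4 x^4 / (x^2 - 4), so it is
   strict. *)
have -> : 8 * x ^+ 4 / (x ^+ 2 - 4) = 2 * (4 * x ^+ 4 / (x ^+ 2 - 4)).
  by rewrite !mulrA -natrM.
rewrite /B; lra.
Qed.
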